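(* Let $d$ and $d_j$ be nonnegative integers and let $\phi_j\colon \mathbb{Z}^d\to\mathbb{Z}^{d_j}$ be group homomorphisms for $j\in\{1,2,\ldots,m\}$, and let $s=(s_1,\ldots,s_m)\in[0,1]^m$. Suppose that $$\operatorname{rank}(H)\le\sum_{j=1}^m s_j\operatorname{rank}(\phi_j(H))\qquad\text{for all subgroups } H\le\mathbb{Z}^d. \tag{A}$$ Then $$|E|\le\prod_{j=1}^m|\phi_j(E)|^{s_j}\qquad\text{for all nonempty finite sets } E\subseteq\mathbb{Z}^d. \tag{B}$$ Conversely, if (B) holds for $s\in[0,1]^m$, then $s$ satisfies (A).
   Context: The rank of an Abelian group is the cardinality of any maximal $\mathbb{Z}$-linearly independent subset. $|\cdot|$ denotes cardinality, and $H\le G$ means that $H$ is a subgroup of $G$. *)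

(* Defs.v *)
From HB Require Import structures.
From mathcomp Require Import all_boot all_order all_algebra.
From mathcomp Require Import finmap.
From mathcomp Require Import all_classical reals exp.

Set Implicit Arguments.
Unset Strict Implicit.
Unset Printing Implicit Defensive.

Import Order.TTheory GRing.Theory Num.Theory.

Local Open Scope classical_set_scope.
Local Open Scope card_scope.
Local Open Scope ring_scope.

Definition zindependent (V : zmodType) (B : set V) : Prop :=
  forall (F : {fset V}) (c : V -> int),
    [set` F] `<=` B ->
    \sum_(x <- F) x *~ c x = 0 ->
    forall x, x \in F -> c x = 0.

Definition maximal_zindependent (V : zmodType) (H B : set V) : Prop :=
  [/\ B `<=` H, zindependent B &
      forall C : set V, B `<=` C -> C `<=` H -> zindependent C -> C = B].

(* The default value 0 is only used when no maximal Z-independent subset of H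
   is finite, which does not happen for subgroups of Z^d. *)
Definition rank (V : zmodType) (H : set V) : nat :=
  xget 0%N [set r : nat |
    exists2 B : set V, maximal_zindependent H B & B #= `I_r].

(* Main.v *)
Require Import Defs.
From HB Require Import structures.
From mathcomp Require Import all_boot all_order all_algebra.
From mathcomp Require Import finmap zify ring lra.
From mathcomp Require Import all_classical reals sequences exp.

(* After tensoring with Q, condition (A) becomes a condition on dimensions of
   subspaces. The inequality, stated for weights [g_j] instead of indicator
   functions, is proved for every section [V / U] of [Q^d]:
     sum_x prod_j g_j (phi_j x) ^ s_j <= prod_j (sum_y g_j y) ^ s_j.
   If some subspace [T] strictly between [U] and [V] satisfies (A) with equality,
   then (A) holds for [T / U] and [V / T], and summing first over the cosets of
   [T] reduces the inequality to these two sections. Otherwise, if at least two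
   exponents are fractional, [s] is moved in both directions along a line on which
   the constraint given by [V] is constant, until an exponent becomes an integer
   or some [T] becomes critical; as the normalized inequality is convex in [s]
   (Hoelder), it holds at [s] if it holds at both end points. Finally, with at
   most one fractional exponent, (A) forces the maps of exponent 1 to be jointly
   injective.
   Conversely, if [x_1, ..., x_r] is a maximal independent subset of [H], then (B)
   for the [N ^ r] combinations of the [x_i] with coefficients in [0, N - 1]
   bounds [N ^ r] by a constant times the power of [N] of exponent
   [sum_j s_j rank (phi_j H)]; let [N] tend to infinity. *)

Set Implicit Arguments.
Unset Strict Implicit.
Unset Printing Implicit Defensive.

Import Order.TTheory GRing.Theory Num.Theory.

Local Open Scope classical_set_scope.
Local Open Scope ring_scope.

(** * Finite sums *)

Section FiniteSums.
Variables (R : realType) (T T' : choiceType).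

Lemma ler_sum_fset (A : {fset T}) (F G : T -> R) :
  (forall x, x \in A -> F x <= G x) -> \sum_(x <- A) F x <= \sum_(x <- A) G x.
Proof. by move=> FG; rewrite big_seq [leRHS]big_seq; apply: ler_sum => x /FG. Qed.

Lemma ler_sum_fsubset (A B : {fset T}) (F : T -> R) :
  (A `<=` B)%fset -> (forall x, 0 <= F x) ->
  \sum_(x <- A) F x <= \sum_(x <- B) F x.
Proof.
move=> AB F0; have /fsetIidPr AE := AB.
rewrite [leRHS](big_fsetID _ (mem A)) /=.
have -> : [fset x in B | x \in A]%fset = A.
  apply/fsetP => x; rewrite !inE /=; apply/andP/idP => [[]//|xA].
  by rewrite (fsubsetP AB).
by rewrite lerDl sumr_ge0.
Qed.

Lemma fset_sum_le1_term (A : {fset T}) (h : T -> R) (x : T) :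
  \sum_(y <- A) expR (h y) <= 1 -> x \in A -> h x <= 0.
Proof.
move=> A1 xA; rewrite -expR_le1; apply: le_trans A1.
by rewrite (big_fsetD1 x)//= lerDl sumr_ge0// => y _; exact: expR_ge0.
Qed.

End FiniteSums.

Lemma expR_convex (R : realType) (a b t : R) : 0 <= t <= 1 ->
  expR (t * a + (1 - t) * b) <= t * expR a + (1 - t) * expR b.
Proof.
move=> /andP[t0 t1].
(* The graph of [expR] lies above its tangent at [c]; at the convex combination the averaged tangent
   values give exactly [expR c]. *)
have h c x : expR c * (1 + (x - c)) <= expR x.
  by rewrite -[in leRHS](subrKC c x) expRD ler_wpM2l ?expR_ge0// expR_ge1Dx.
set c := t * a + _.
have -> : expR c =
    t * (expR c * (1 + (a - c))) + (1 - t) * (expR c * (1 + (b - c))).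
  by rewrite /c; ring.
by rewrite lerD ?ler_wpM2l ?subr_ge0 ?h.
Qed.

Lemma expRN_ln_mul_le1 (R : realType) (L : R) : 0 <= L -> expR (- ln L) * L <= 1.
Proof.
rewrite le_eqVlt => /predU1P[<-|L0]; first by rewrite mulr0.
by rewrite expRN lnK ?posrE// mulVf ?gt_eqF.
Qed.

(* Fubini, one coordinate at a time: a set that the maps [q i] separate embeds
   in the product of its images. *)
Lemma sum_expR_separating (R : realType) (I : eqType) (T T' : choiceType)
    (q : I -> T -> T') (h : I -> T' -> R) (r : seq I) (E : {fset T}) :
  {in E &, forall x y, {in r, forall i, q i x = q i y} -> x = y} ->
  {in r, forall i, \sum_(y <- [fset q i x | x in E]%fset) expR (h i y) <= 1} ->
  \sum_(x <- E) expR (\sum_(i <- r) h i (q i x)) <= 1.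
Proof.
elim: r E => [|i r IH] E sep h1.
  have [->|[x0 x0E]] := fset_0Vmem E; first by rewrite big_seq_fset0.
  have -> : E = [fset x0]%fset.
    apply/fsetP => x; rewrite !inE; apply/idP/eqP => [xE|->//].
    exact: sep.
  by rewrite big_seq_fset1 big_nil expR0.
rewrite (partition_big_imfset _ (q i)) /=.
apply: le_trans (h1 i (mem_head _ _)); apply: ler_sum_fset => y _.
rewrite big_fset_condE; set Ey := [fset x in E | q i x == y]%fset.
have -> : \sum_(x <- Ey) expR (\sum_(k <- i :: r) h k (q k x)) =
          expR (h i y) * \sum_(x <- Ey) expR (\sum_(k <- r) h k (q k x)).
  rewrite mulr_sumr; apply: eq_big_seq => x.
  by rewrite !inE /= => /andP[_ /eqP<-]; rewrite big_cons expRD.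
rewrite ler_piMr ?expR_ge0//; apply: IH => [x x'|k kr].
  rewrite !inE => /andP[xE /eqP xy] /andP[x'E /eqP x'y] xx'.
  apply: sep => // k; rewrite inE => /predU1P[->|/xx'//].
  by rewrite xy x'y.
apply: le_trans (h1 k _); last by rewrite inE kr orbT.
apply: ler_sum_fsubset => [|z]; last exact: expR_ge0.
apply/fsubsetP => z /imfsetP[x /= + ->]; rewrite !inE => /andP[xE _].
exact: in_imfset.
Qed.

(** * Sections of a vector space *)

Section BrascampLieb.
Variables (R : realType) (K : fieldType) (vT : vectType K) (m : nat).
Variable (ker : 'I_m -> {vspace vT}).
Implicit Types (s : 'I_m -> R) (U V T W : {vspace vT}).

(** A canonical representative of the coset of [x] modulo [U], so that quotients are handled inside
    [vT]. *)
Definition residue U (x : vT) : vT := x - projv U x.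

Lemma sub_residue U x : x - residue U x \in U.
Proof. by rewrite /residue opprB addrC subrK memv_proj. Qed.

Lemma residueB U x y : residue U (x - y) = residue U x - residue U y.
Proof. by rewrite /residue linearB /= !opprB [X in _ + X]addrC addrACA [- y + _]addrC. Qed.

Lemma eq_residue U x y : (residue U x == residue U y) = (x - y \in U).
Proof.
rewrite -subr_eq0 -residueB /residue subr_eq0.
by apply/eqP/idP => [->|/projv_id->//]; exact: memv_proj.
Qed.

Lemma residue_residue U T x : (U <= T)%VS -> residue T (residue U x) = residue T x.
Proof.
move=> UT; apply/eqP; rewrite eq_residue -memvN opprB.
exact: subvP UT _ (sub_residue _ _).
Qed.

(* The rank condition (A) for the quotient [V / U] and the maps it inherits,
   [ker j] being the kernel of the [j]-th map: the image of [W / U] under the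
   latter is isomorphic to [(W + ker j) / (U + ker j)]. *)
Definition rank_condition s U V := forall W, (U <= W)%VS -> (W <= V)%VS ->
  (\dim W)%:R - (\dim U)%:R <=
  \sum_(j < m) s j * ((\dim (W + ker j))%:R - (\dim (U + ker j))%:R).

(* The inequality for [V / U], with weights [expR (h j y)] in place of indicator
   functions; [E] is a set of representatives of cosets of [U] in a coset
   of [V], and the image of [x] under the [j]-th map is encoded by its residue. *)
Definition BL_inequality s U V := forall (E : {fset vT}) (h : 'I_m -> vT -> R),
  {in E &, forall x y, x - y \in V} ->
  {in E &, forall x y, x - y \in U -> x = y} ->
  (forall j, \sum_(y <- [fset residue (U + ker j) x | x in E]%fset)
               expR (h j y) <= 1) ->
  \sum_(x <- E) expR (\sum_j s j * h j (residue (U + ker j) x)) <= 1.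

(** The constraint on [h] does not involve the exponents, and for fixed [h] each summand is the
    exponential of a linear function of them. *)
Lemma BL_inequality_convex s1 s2 t U V : 0 <= t <= 1 ->
  BL_inequality s1 U V -> BL_inequality s2 U V ->
  BL_inequality (fun j => t * s1 j + (1 - t) * s2 j) U V.
Proof.
move=> t01 F1 F2 E h EV EU h1; have /andP[t0 t1] := t01.
have {F1} := F1 E h EV EU h1; have {F2} := F2 E h EV EU h1.
set S2 := \sum_(x <- E) _; set S1 := \sum_(x <- E) _ => S21 S11.
suff: \sum_(x <- E) expR (\sum_j (t * s1 j + (1 - t) * s2 j) *
    h j (residue (U + ker j) x)) <= t * S1 + (1 - t) * S2.
  move=> /le_trans; apply.
  have : t * S1 <= t by rewrite ler_piMr.
  have : (1 - t) * S2 <= 1 - t by rewrite ler_piMr// subr_ge0.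
  lra.
rewrite !mulr_sumr -big_split /=; apply: ler_sum => x _.
apply: le_trans (expR_convex _ _ t01).
rewrite ler_expR !mulr_sumr -big_split /= le_eqVlt; apply/orP; left; apply/eqP.
by apply: eq_bigr => j _; ring.
Qed.

(** The normalization makes [h j] nonpositive on the image of [E], so larger exponents only decrease
    the summands. *)
Lemma BL_inequality_mono s1 s2 U V : (forall j, s1 j <= s2 j) ->
  BL_inequality s1 U V -> BL_inequality s2 U V.
Proof.
move=> s12 F E h EV EU h1; apply: le_trans (F E h EV EU h1).
apply: ler_sum_fset => x xE; rewrite ler_expR; apply: ler_sum => j _.
rewrite ler_wnM2r//; apply: fset_sum_le1_term (h1 j) _.
exact: in_imfset.
Qed.

Lemma BL_inequality_split s U T V : (U <= T)%VS -> (T <= V)%VS ->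
  BL_inequality s U T -> BL_inequality s T V -> BL_inequality s U V.
Proof.
move=> UT TV FU FT E h EV EU h1.
pose qU j := residue (U + ker j); pose qT j := residue (T + ker j).
have qTU j x : qT j (qU j x) = qT j x.
  by apply: residue_residue; exact: addvS.
have qTT j x : qT j (residue T x) = qT j x.
  by apply: residue_residue; exact: addvSl.
(* The mass of the fibre over [w] in the [j]-th image; these masses are the weights used for
   [V / T]. *)
pose L j w := \sum_(y <- [fset qU j x | x in E]%fset | qT j y == w) expR (h j y).
have L0 j w : 0 <= L j w by apply: sumr_ge0 => *; exact: expR_ge0.
pose E' := [fset residue T x | x in E]%fset.
have E'1 : \sum_(z <- E') expR (\sum_j s j * ln (L j (qT j z))) <= 1.
  apply: (FT E' (fun j w => ln (L j w))) => [z z'|z z'|j].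
  - move=> /imfsetP[x xE ->] /imfsetP[y yE ->]; rewrite -residueB.
    by rewrite memvB ?EV// (subvP TV)// memv_proj.
  - move=> /imfsetP[x xE ->] /imfsetP[y yE ->]; rewrite -eq_residue.
    by rewrite !residue_residue// => /eqP.
  - have -> : [fset residue (T + ker j) x | x in E']%fset =
              [fset qT j y | y in [fset qU j x | x in E]]%fset.
      apply/fsetP => w; apply/imfsetP/imfsetP => -[z /imfsetP[x xE ->] ->].
        exists (qU j x); last by rewrite -!/(qT j _) qTT qTU.
        exact: in_imfset.
      exists (residue T x); last by rewrite -!/(qT j _) qTU qTT.
      exact: in_imfset.
    apply: le_trans (h1 j); rewrite [leRHS](partition_big_imfset _ (qT j)) /=.
    apply: ler_sum_fset => w /imfsetP[y yE ->].
    rewrite lnK// posrE /L big_fset_condE (big_fsetD1 y)/=; last first.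
      by rewrite !inE /= eqxx andbT.
    rewrite ltr_wpDr ?expR_gt0// sumr_ge0// => *; exact: expR_ge0.
rewrite (partition_big_imfset _ (residue T)) /=.
apply: le_trans E'1; apply: ler_sum_fset => z zE'.
rewrite big_fset_condE; set Ez := [fset x in E | residue T x == z]%fset.
(* Inside one coset of [T], dividing by the fibre mass normalizes the weights for [T / U]; the
   factor taken out is a term of the sum in [E'1]. *)
pose h' j y := h j y - ln (L j (qT j y)).
have EzP x : x \in Ez -> x \in E /\ residue T x = z.
  by rewrite !inE => /andP[? /eqP].
have -> : \sum_(x <- Ez) expR (\sum_j s j * h j (qU j x)) =
          expR (\sum_j s j * ln (L j (qT j z))) *
          \sum_(x <- Ez) expR (\sum_j s j * h' j (qU j x)).
  rewrite mulr_sumr; apply: eq_big_seq => x /EzP[xE <-].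
  rewrite -expRD -big_split /=; congr expR; apply: eq_bigr => j _.
  by rewrite /h' qTU qTT; ring.
rewrite ler_piMr ?expR_ge0//; apply: FU => [x y|x y|j].
- by move=> /EzP[_ xz] /EzP[_ yz]; rewrite -eq_residue xz yz.
- by move=> /EzP[xE _] /EzP[yE _]; exact: EU.
- have -> : \sum_(y <- [fset residue (U + ker j) x | x in Ez]%fset) expR (h' j y) =
     expR (- ln (L j (qT j z))) *
       \sum_(y <- [fset residue (U + ker j) x | x in Ez]%fset) expR (h j y).
    rewrite mulr_sumr; apply: eq_big_seq => y /imfsetP[x /EzP[xE <-] ->].
    by rewrite /h' qTU qTT -expRD addrC.
  apply: le_trans (expRN_ln_mul_le1 (L0 j (qT j z))).
  rewrite ler_wpM2l ?expR_ge0// /L [leRHS]big_fset_condE.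
  apply: ler_sum_fsubset => [|y]; last exact: expR_ge0.
  apply/fsubsetP => y /imfsetP[x /EzP[xE <-] ->]; rewrite !inE /= qTU qTT eqxx andbT.
  exact: in_imfset.
Qed.

End BrascampLieb.

(** * The inequality under the rank condition *)

(** The least of the times [a i / - b i] over the decreasing coordinates is the first time at which
    one of them vanishes. *)
Lemma first_hit (R : realFieldType) (I : finType) (a b : I -> R) (i0 : I) :
  (forall i, 0 <= a i) -> b i0 < 0 ->
  exists t, [/\ 0 <= t, forall i, 0 <= a i + t * b i &
                exists2 i, b i < 0 & a i + t * b i = 0].
Proof.
move=> a0 bi0; have [i bi imin] := @arg_minP _ _ I i0 [pred i | b i < 0] (fun i => a i / - b i) bi0.
have bi' : b i < 0 by [].
exists (a i / - b i); split.
- by rewrite divr_ge0// oppr_ge0 ltW.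
- move=> k; have [bk|bk] := ltP (b k) 0; last first.
    by rewrite addr_ge0// mulr_ge0// divr_ge0// oppr_ge0 ltW.
  have := imin k bk; rewrite ler_pdivlMr ?oppr_gt0// => h.
  by move: h; rewrite mulrN lerNl -subr_ge0 opprK addrC.
- by exists i => //; rewrite invrN mulrN mulNr mulfVK ?subrr// lt_eqF.
Qed.

Section RankCondition.
Variables (R : realType) (K : fieldType) (vT : vectType K) (m : nat).
Variable (ker : 'I_m -> {vspace vT}).
Implicit Types (s : 'I_m -> R) (U V T W : {vspace vT}).

(** For [U <= W], the dimension of the image of [W / U] under the [j]-th map. *)
Definition codim U W j : R := (\dim (W + ker j))%:R - (\dim (U + ker j))%:R.

Definition rank_gap s U W : R :=
  \sum_j s j * codim U W j - ((\dim W)%:R - (\dim U)%:R).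

Definition critical s U V T := [/\ (U <= T)%VS, (T <= V)%VS,
  (\dim U < \dim T < \dim V)%N & rank_gap s U T = 0].

Definition fractional s := [set j | 0 < s j < 1]%SET.

Lemma rank_conditionE s U V : rank_condition ker s U V <->
  (forall W, (U <= W)%VS -> (W <= V)%VS -> 0 <= rank_gap s U W).
Proof.
by split=> h W UW WV; [rewrite subr_ge0|rewrite -subr_ge0]; exact: h.
Qed.

Lemma codim_ge0 U W j : (U <= W)%VS -> 0 <= codim U W j.
Proof. by move=> UW; rewrite subr_ge0 ler_nat dimvS// addvS. Qed.

Lemma codim_le U W j : (U <= W)%VS -> codim U W j <= (\dim W)%:R - (\dim U)%:R.
Proof.
move=> UW; rewrite /codim lerBrDr addrAC lerBlDr -!natrD ler_nat.
have := dimv_sum_cap W (ker j); have := dimv_sum_cap U (ker j).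
have : (\dim (U :&: ker j) <= \dim (W :&: ker j))%N by rewrite dimvS ?capvS.
lia.
Qed.

Lemma codim_split U T W j : codim U W j = codim U T j + codim T W j.
Proof. by rewrite /codim; ring. Qed.

Lemma rank_gap_split s U T W : rank_gap s U W = rank_gap s U T + rank_gap s T W.
Proof.
rewrite /rank_gap.
rewrite (eq_bigr (fun j => s j * codim U T j + s j * codim T W j)); last first.
  by move=> j _; rewrite (codim_split U T W) mulrDr.
by rewrite big_split /=; ring.
Qed.

(** The gap is additive along chains and vanishes from [U] to [T], so above [T] it is the same
    relative to [T] as to [U]. *)
Lemma rank_condition_critical s U V T : critical s U V T ->
  rank_condition ker s U V ->
  rank_condition ker s U T /\ rank_condition ker s T V.
Proof.
move=> [UT TV _ T0] /rank_conditionE A; split; apply/rank_conditionE => W UW WV.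
  by apply: A => //; exact: subv_trans TV.
have := A W (subv_trans UT UW) WV.
by rewrite (rank_gap_split _ _ T) T0 add0r.
Qed.

(* With at most one fractional exponent, (A) makes the maps of exponent [1]
   jointly injective, and those already give the inequality. *)
Lemma BL_inequality_le1_fractional s U V : (U <= V)%VS ->
  (forall j, 0 <= s j <= 1) -> {in fractional s &, forall j k, j = k} ->
  rank_condition ker s U V -> BL_inequality ker s U V.
Proof.
move=> UV s01 frac1 A.
apply: (@BL_inequality_mono _ _ _ _ _ (fun j => (s j == 1)%:R)) => [j|].
  by have /andP[s0 _] := s01 j; case: eqP => [->|].
(* [W / U] is the common kernel in [V / U] of the maps of exponent 1. *)
set W := (V :&: \bigcap_(j | s j == 1) (U + ker j))%VS.
have UW : (U <= W)%VS.
  by rewrite subv_cap UV; apply/subv_bigcapP => j _; exact: addvSl.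
have WV : (W <= V)%VS by exact: capvSl.
have codim0 j : s j = 1 -> codim U W j = 0.
  move=> sj; suff WU : (W + ker j)%VS = (U + ker j)%VS by rewrite /codim WU subrr.
  apply/eqP; rewrite eqEsubv [X in _ && X]addvS// andbT subv_add addvSr andbT.
  by apply: subv_trans (capvSr _ _) _; apply: (bigcapv_inf j); rewrite ?sj.
have WU : W = U.
  apply/esym/eqP; rewrite eqEdim UW /= -(ler_nat R) -subr_le0.
  (* On [W / U] only a fractional exponent can contribute, so at most one does; by (A) the dimension
     of [W / U] is at most [c < 1] times itself, hence 0. *)
  have [c c1 sc] : exists2 c, c < 1 &
      \sum_j s j * codim U W j <= c * ((\dim W)%:R - (\dim U)%:R).
    have other j : j \notin fractional s -> s j * codim U W j = 0.
      rewrite inE; have /andP[s0 s1] := s01 j; rewrite negb_and -!leNgt.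
      case/orP=> sj; first by rewrite (@le_anti _ _ (s j) 0) ?mul0r// sj.
      by rewrite codim0 ?mulr0//; apply/le_anti/andP.
    case: (pickP [in fractional s]) => [j0 /= j0P|none].
      have /andP[_ j01] : 0 < s j0 < 1 by move: j0P; rewrite inE.
      exists (s j0) => //; rewrite (bigD1 j0)//= big1 ?addr0 => [|j /eqP jj0].
        by rewrite ler_wpM2l ?codim_le//; case/andP: (s01 j0).
      by apply: other; apply/negP => jP; exact: jj0 (frac1 _ _ jP j0P).
    by exists 0; rewrite ?ltr01// mul0r big1// => j _; rewrite other ?none.
  have := A W UW WV; rewrite -/(codim _ _ _) => h.
  have c1' : 0 < 1 - c by rewrite subr_gt0.
  rewrite -(pmulr_rle0 _ c1') mulrBl mul1r subr_le0; exact: le_trans h sc.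
move=> E h EV EU h1.
rewrite (eq_bigr (fun x => expR (\sum_(j <- enum [pred j | s j == 1])
                              h j (residue (U + ker j) x)))); last first.
  move=> x _; congr expR; rewrite big_enum /= [RHS]big_mkcond /=.
  by apply: eq_bigr => j _; rewrite inE; case: eqP; rewrite ?mul1r ?mul0r.
apply: (sum_expR_separating (q := fun j => residue (U + ker j)));
  last by move=> j _; exact: h1.
move=> x y xE yE xy.
apply: EU => //; rewrite -WU memv_cap EV//= memvE; apply/subv_bigcapP => j sj.
by rewrite -memvE -eq_residue; apply/eqP/xy; rewrite mem_enum.
Qed.

(** Raising [s j] at rate [b] while lowering [s k] at rate [a] keeps the gap at [V] constant; the
    move stops as soon as a constraint becomes tight. *)
Lemma rank_condition_move s U V j k (a := codim U V j) (b := codim U V k)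
    (v := fun i => if i == j then b else if i == k then - a else 0) :
  (U <= V)%VS -> (forall i, 0 <= s i <= 1) -> rank_condition ker s U V ->
  j != k -> j \in fractional s -> k \in fractional s -> 0 < a -> 0 < b ->
  exists t (s' := fun i => s i + t * v i),
  [/\ 0 <= t, forall i, 0 <= s' i <= 1, rank_condition ker s' U V,
      (#|fractional s'| <= #|fractional s|)%N &
      (#|fractional s'| < #|fractional s|)%N \/ exists T, critical s' U V T].
Proof.
move=> UV s01 /rank_conditionE A jk jf kf a0 b0.
have vj : v j = b by rewrite /v eqxx.
have vk : v k = - a by rewrite /v eq_sym (negbTE jk) eqxx.
have /andP[sj0 sj1] : 0 < s j < 1 by move: jf; rewrite inE.
have /andP[sk0 sk1] : 0 < s k < 1 by move: kf; rewrite inE.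
pose slope W := \sum_i v i * codim U W i.
have gapD t W : rank_gap (fun i => s i + t * v i) U W = rank_gap s U W + t * slope W.
  rewrite /rank_gap /slope addrAC; congr (_ - _).
  rewrite mulr_sumr -big_split /=; apply: eq_bigr => i _; ring.
have slopeE W : slope W = b * codim U W j - a * codim U W k.
  rewrite /slope (bigD1 j)//= (bigD1 k) 1?eq_sym//= big1 ?addr0 ?vj ?vk ?mulNr//.
  by move=> i /andP[/negbTE ij /negbTE ik]; rewrite /v ij ik mul0r.
(* The conditions on [W] depend only on finitely many dimensions, so they are
   finite in number. *)
pose profile W : {ffun option 'I_m -> 'I_(\dim {:vT}).+1} :=
  [ffun o => inord (if o is Some i then \dim (W + ker i) else \dim W)].
have profile_eq W W' : profile W = profile W' ->
    \dim W = \dim W' /\ forall i, \dim (W + ker i) = \dim (W' + ker i).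
  have dimP (X : {vspace vT}) : (\dim X < (\dim {:vT}).+1)%N by rewrite ltnS dimvS ?subvf.
  move=> WW'; split=> [|i].
    move/ffunP/(_ None)/(congr1 (@nat_of_ord _)): WW'.
    by rewrite !ffunE !inordK.
  move/ffunP/(_ (Some i))/(congr1 (@nat_of_ord _)): WW'.
  by rewrite !ffunE !inordK.
pose between W := (U <= W)%VS && (W <= V)%VS.
(* One subspace for each profile that occurs; the default [U] also lies between [U] and [V]. *)
pose wit p := xget U [set W | between W /\ profile W = p].
have witP W : between W -> between (wit (profile W)) /\ profile (wit (profile W)) = profile W.
  by move=> bW; rewrite /wit; case: xgetP => [W' _ []|/(_ W)[]].
have wit_between p : between (wit p).
  by rewrite /wit; case: xgetP => [W' _ []//|_]; rewrite /between subvv.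
(* [al] lists the quantities that must stay nonnegative, [be] their rates of change. *)
pose al (o : bool + {ffun option 'I_m -> 'I_(\dim {:vT}).+1}) :=
  match o with inl true => 1 - s j | inl false => s k | inr p => rank_gap s U (wit p) end.
pose be (o : bool + {ffun option 'I_m -> 'I_(\dim {:vT}).+1}) :=
  match o with inl true => - b | inl false => - a | inr p => slope (wit p) end.
have [||t [t0 tpos [o slo tz]]] := @first_hit R _ al be (inl true).
- move=> [[]|p] /=; [by rewrite subr_ge0 ltW|exact: ltW|].
  by have /andP[] := wit_between p; exact: A.
- by rewrite oppr_lt0.
exists t => s'.
have s'j : s' j <= 1.
  have := tpos (inl true); rewrite /s' /= vj; lra.
have s'k : 0 <= s' k.
  have := tpos (inl false); rewrite /s' /= vk; lra.
have s'j0 : 0 < s' j by rewrite /s' vj ltr_wpDr// mulr_ge0// ltW.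
have s'k1 : s' k < 1.
  by rewrite /s' vk mulrN ltrBlDr ltr_wpDr// mulr_ge0// ltW.
have s'E i : i != j -> i != k -> s' i = s i.
  by rewrite /s' /v => /negbTE-> /negbTE->; rewrite mulr0 addr0.
have fs' : fractional s' \subset fractional s.
  apply/fintype.subsetP => i; have [->//|ij] := eqVneq i j; have [->//|ik] := eqVneq i k.
  by rewrite !inE s'E.
have gap_wit W : between W -> rank_gap s' U (wit (profile W)) = rank_gap s' U W.
  move=> /witP[_ /profile_eq[d1 d2]]; rewrite /rank_gap d1; congr (_ - _).
  by apply: eq_bigr => i _; rewrite /codim d2.
split=> //.
- move=> i; have [->|ij] := eqVneq i j; first by rewrite s'j ltW.
  by have [->|ik] := eqVneq i k; [rewrite s'k ltW|rewrite s'E].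
- apply/rank_conditionE => W UW WV.
  rewrite -gap_wit ?gapD; last by rewrite /between UW.
  exact: (tpos (inr (profile W))).
- exact: subset_leq_card.
- case: o slo tz => [[]|p] /= slo tz.
  + left; apply/proper_card/properP; split=> //; exists j => //.
    rewrite inE; apply/negP => /andP[_]; rewrite /s' vj; lra.
  + left; apply/proper_card/properP; split=> //; exists k => //.
    rewrite inE; apply/negP => /andP[+ _]; rewrite /s' vk; lra.
  + right; exists (wit p); have /andP[UW WV] := wit_between p.
    split=> //; last by rewrite gapD.
    (* The tight subspace has negative slope, whereas [U] and [V] have slope 0, so it lies strictly
       between them. *)
    have ne X : slope X = 0 -> wit p <> X by move=> X0 pX; move: slo; rewrite pX X0 ltxx.
    have sU : slope U = 0 by rewrite slopeE /codim !subrr !mulr0 subrr.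
    have sV : slope V = 0 by rewrite slopeE -/a -/b mulrC subrr.
    rewrite !ltn_neqAle !dimvS// !andbT; apply/andP; split; apply/eqP => d.
      by apply: (ne U sU); apply/esym/eqP; rewrite eqEdim UW d leqnn.
    by apply: (ne V sV); apply/eqP; rewrite eqEdim WV d leqnn.
Qed.

(** A map that kills [V / U] kills every [W / U], so its term in (A) is 0. *)
Lemma rank_condition_zero s U V j : (U <= V)%VS -> codim U V j <= 0 ->
  rank_condition ker s U V ->
  rank_condition ker (fun i => if i == j then 0 else s i) U V.
Proof.
move=> UV V0 A W UW WV; apply: le_trans (A W UW WV) _.
apply: ler_sum => i _; case: eqP => // ->.
rewrite mul0r -/(codim U W j).
suff -> : codim U W j = 0 by rewrite mulr0.
apply/le_anti; rewrite codim_ge0// andbT.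
by apply: le_trans V0; rewrite lerD2r ler_nat dimvS// addvS.
Qed.

Lemma BL_inequality_of_rank s U V : (U <= V)%VS ->
  (forall j, 0 <= s j <= 1) -> rank_condition ker s U V ->
  BL_inequality ker s U V.
Proof.
(* A critical subspace lowers the first summand of this measure, an exponent becoming an integer
   lowers the second. *)
have [n] := ubnP (\dim V - \dim U + #|fractional s|)%N.
elim: n U V s => // n IH U V s; rewrite ltnS => sn UV s01 A.
have step s' : (forall j, 0 <= s' j <= 1) -> rank_condition ker s' U V ->
    (#|fractional s'| <= #|fractional s|)%N ->
    (#|fractional s'| < #|fractional s|)%N \/ (exists T, critical s' U V T) ->
    BL_inequality ker s' U V.
  move=> s'01 A' fs [fs'|[T cT]].
    by apply: IH => //; apply: leq_trans sn; rewrite ltn_add2l.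
  have [A1 A2] := rank_condition_critical cT A'; case: cT => UT TV /andP[d1 d2] _.
  by apply: (BL_inequality_split UT TV); apply: IH => //; lia.
have [cT|nocrit] := pselect (exists T, critical s U V T).
  by apply: step => //; right.
have [f1|] := pselect {in fractional s &, forall j k, j = k}.
  exact: BL_inequality_le1_fractional.
move=> /existsNP[j /existsNP[k /not_implyP[jf /not_implyP[kf /eqP jk]]]].
have drop i : i \in fractional s -> codim U V i <= 0 -> BL_inequality ker s U V.
  move=> iF V0; apply: (@BL_inequality_mono _ _ _ _ _ (fun l => if l == i then 0 else s l)).
    by move=> l; case: eqP => // _; case/andP: (s01 l).
  have lt : (#|fractional (fun l => if l == i then 0%R else s l)| < #|fractional s|)%N.
    apply/proper_card/properP; split; last by exists i => //; rewrite inE eqxx ltxx.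
    by apply/fintype.subsetP => l; rewrite !inE; case: eqP => // _; rewrite ltxx.
  apply: step => //; first by move=> l; case: eqP => // _; rewrite lexx ler01.
  - exact: rank_condition_zero.
  - exact: ltnW.
  - by left.
have [a0|a0] := leP (codim U V j) 0; first exact: drop a0.
have [b0|b0] := leP (codim U V k) 0; first exact: drop b0.
have [t1 [t10 B1 A1 f1 c1]] := rank_condition_move UV s01 A jk jf kf a0 b0.
have kj : k != j by rewrite eq_sym.
(* Exchanging [j] and [k] reverses the direction of the move. *)
have [t2 [t20 B2 A2 f2 c2]] := rank_condition_move UV s01 A kj kf jf b0 a0.
have F1 := step _ B1 A1 f1 c1; have F2 := step _ B2 A2 f2 c2.
(* With this weight the displacements [t1] and [- t2] cancel. If both are 0, the end points coincide
   with [s] and the quotient is 0 by convention. *)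
have t01 : 0 <= t2 / (t1 + t2) <= 1.
  have [D0|D0] := eqVneq (t1 + t2) 0; first by rewrite D0 invr0 mulr0 lexx ler01.
  by rewrite divr_ge0 ?addr_ge0//= ler_pdivrMr ?mul1r ?lerDr// lt_neqAle eq_sym D0 addr_ge0.
apply: BL_inequality_mono (BL_inequality_convex t01 F1 F2) => i.
suff h x : t2 / (t1 + t2) * (s i + t1 * x) +
   (1 - t2 / (t1 + t2)) * (s i + t2 * (- x)) = s i.
  rewrite /=; have [ij|ij] := eqVneq i j; first
    by rewrite [i == k](_ : _ = false) ?h// ij; exact/negbTE.
  have [ik|ik] := eqVneq i k; last by have := h 0; rewrite oppr0 => ->.
  by have := h (- codim U V j); rewrite opprK => ->.
have [D0|D0] := eqVneq (t1 + t2) 0; last by field.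
have -> : t2 = 0 by lra.
by rewrite !mul0r; ring.
Qed.

End RankCondition.

(** * Rank and rational span *)

Lemma common_denominator (T : eqType) (X : seq T) (c : T -> rat) :
  exists2 D : int, D != 0 &
    exists k : T -> int, {in X, forall x, (k x)%:~R = D%:~R * c x}.
Proof.
elim: X => [|x X [D D0 [k kD]]]; first by exists 1 => //; exists (fun=> 0).
exists (D * denq (c x)); first by rewrite mulf_neq0 ?denq_neq0.
exists (fun y => if y == x then D * numq (c x) else k y * denq (c x)) => y.
rewrite inE; case: eqVneq => [-> _|_ /= yX]; rewrite !intrM.
  by rewrite numqE mulrA mulrAC.
by rewrite kD// mulrAC.
Qed.

Definition toQ n (x : 'rV[int]_n) : 'rV[rat]_n := map_mx intr x.

Lemma toQ_inj n : injective (@toQ n).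
Proof.
move=> x y /rowP xy; apply/rowP => i; apply: (@intr_inj rat).
by have := xy i; rewrite !mxE.
Qed.

Lemma toQB n (x y : 'rV[int]_n) : toQ (x - y) = toQ x - toQ y.
Proof. exact: raddfB. Qed.

Lemma toQ0 n : toQ (0 : 'rV[int]_n) = 0.
Proof. exact: raddf0. Qed.

Lemma toQ_lincomb n (I : Type) (r : seq I) (x : I -> 'rV[int]_n) (c : I -> int) :
  toQ (\sum_(i <- r) x i *~ c i) = \sum_(i <- r) (c i)%:~R *: toQ (x i).
Proof.
rewrite /toQ raddf_sum; apply: eq_bigr => i _.
by rewrite raddfMz scaler_int.
Qed.

Lemma toQ_multiple n (v : 'rV[rat]_n) :
  exists2 D : int, D != 0 & exists x, toQ x = D%:~R *: v.
Proof.
have [D D0 [k kD]] := common_denominator (enum 'I_n) (v 0).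
exists D => //; exists (\row_i k i); apply/rowP => i.
by rewrite !mxE kD// mem_enum.
Qed.

Section Rank.
Variable n : nat.
Implicit Types (H B : set 'rV[int]_n) (X : seq 'rV[int]_n) (F : {fset 'rV[int]_n}).
Implicit Type (W : {vspace 'rV[rat]_n}).

Definition qspan X := <<map (@toQ n) X>>%VS.

Definition qfree X := free (map (@toQ n) X).

Lemma mem_qspan X x : x \in X -> toQ x \in qspan X.
Proof. by move=> xX; apply/memv_span/map_f. Qed.

Lemma qspan_le X W : {in X, forall x, toQ x \in W} -> (qspan X <= W)%VS.
Proof. by move=> XW; apply/span_subvP => _ /mapP[x /XW xW ->]. Qed.

(** A rational relation becomes an integral one after multiplication by a common denominator. *)
Lemma qfreeP X : uniq X ->
  qfree X <-> (forall c : 'rV[int]_n -> int, \sum_(x <- X) x *~ c x = 0 ->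
               {in X, forall x, c x = 0}).
Proof.
move=> uX; have sX : size (map (@toQ n) X) = size X by rewrite size_map.
have nthX (i : 'I_(size (map (@toQ n) X))) : (map (@toQ n) X)`_i = toQ X`_i.
  by rewrite (nth_map 0) -?sX.
split=> [fX c c0 x xX|ind].
  have /freeP fX' : free (in_tuple (map (@toQ n) X)) by [].
  have ltx : (index x X < size (map (@toQ n) X))%N by rewrite sX index_mem.
  have := fX' (fun i => (c X`_i)%:~R) _ (Ordinal ltx).
  rewrite /= nth_index// => h; apply/eqP; rewrite -(intr_eq0 rat); apply/eqP/h.
  transitivity (toQ (\sum_(x <- X) x *~ c x)); last by rewrite c0 toQ0.
  rewrite toQ_lincomb (big_nth 0) big_mkord -sX.
  by apply: eq_bigr => i _; rewrite nthX.
change (free (in_tuple (map (@toQ n) X))); apply/freeP => k k0 i.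
(* Coefficients pass from positions to vectors, consistently because the entries of [X] are
   distinct. *)
pose kk x : rat := if insub (index x X) is Some i then k i else 0.
have kkE (l : 'I_(size (map (@toQ n) X))) : kk X`_l = k l.
  by rewrite /kk index_uniq -?sX// valK.
have [D D0 [c cD]] := common_denominator X kk.
have iX : X`_i \in X by rewrite mem_nth -?sX.
have : c X`_i = 0.
  apply: ind iX; apply: (@toQ_inj n); rewrite toQ0 toQ_lincomb.
  rewrite (eq_big_seq (fun x => D%:~R *: (kk x *: toQ x))); last first.
    by move=> x xX; rewrite cD// scalerA.
  rewrite -scaler_sumr (big_nth 0) big_mkord -sX.
  rewrite (eq_bigr (fun l => k l *: (map (@toQ n) X)`_l)) ?k0 ?scaler0// => l _.
  by rewrite kkE nthX.
move/(congr1 (fun z : int => z%:~R : rat)); rewrite cD// kkE => /eqP.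
by rewrite mulf_eq0 intr_eq0 (negbTE D0) /= => /eqP.
Qed.

Lemma zindependent_fset F : zindependent [set` F] <-> qfree F.
Proof.
split=> [ind|/(qfreeP (fset_uniq F)) fF F' c F'F c0 x xF'].
  by apply/(qfreeP (fset_uniq F)) => c c0 x xF; exact: ind c0 _ xF.
have := fF (fun x => if x \in F' then c x else 0) _ x (F'F _ xF').
rewrite xF'; apply; rewrite -[RHS]c0; apply/esym.
rewrite (eq_big_seq (fun x => x *~ (if x \in F' then c x else 0))) => [|y ->//].
apply: big_fset_incl; first by apply/fsubsetP => y /F'F.
by move=> y _ /negbTE ->; rewrite mulr0z.
Qed.

Lemma qfreeU1 F x : x \notin F ->
  qfree (x |` F)%fset = (toQ x \notin qspan F) && qfree F.
Proof.
move=> xF; rewrite /qfree -free_cons -map_cons; apply/perm_free/perm_map.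
apply: uniq_perm; rewrite /= ?xF ?fset_uniq// => y.
by rewrite !inE.
Qed.

Lemma sub_zindependent B B' : B `<=` B' -> zindependent B' -> zindependent B.
Proof. by move=> BB' ind F c FB; apply: ind; exact: subset_trans BB'. Qed.

Lemma exists_qbasis X : exists F, [/\ {subset F <= X}, qfree F &
  (qspan X <= qspan F)%VS].
Proof.
elim: X => [|x X [F [FX fF XF]]].
  by exists fset0; split=> //; rewrite /qfree [map _ _]size0nil ?nil_free// size_map cardfs0.
have [xF|xF] := boolP (toQ x \in qspan F).
  exists F; split=> //; first by move=> y /FX; rewrite inE orbC => ->.
  apply: qspan_le => y; rewrite inE => /predU1P[->//|/mem_qspan].
  exact/subvP.
have xF' : x \notin F by apply: contra xF; exact: mem_qspan.
exists (x |` F)%fset; split.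
- move=> y; rewrite !inE => /predU1P[->|/FX->]; by rewrite ?eqxx ?orbT.
- by rewrite qfreeU1// xF.
- apply: qspan_le => y; rewrite inE => /predU1P[->|yX].
    by apply: mem_qspan; rewrite !inE eqxx.
  apply: subvP (mem_qspan yX); apply: subv_trans XF _.
  by apply: qspan_le => z zF; apply: mem_qspan; rewrite !inE zF orbT.
Qed.

(** An element of [X] outside the span of a maximal independent set could be added to it. The
    default value of [rank] is excluded because a free part of [X] with the same span is maximal. *)
Lemma rank_qspan H X : (forall x, x \in X -> H x) ->
  (forall x, H x -> toQ x \in qspan X) -> rank H = \dim (qspan X).
Proof.
move=> XH HX; rewrite /rank; case: xgetP => [r _ [B [BH Bind Bmax] Br]|none].
  have /finite_fsetP[F BF] : finite_set B by exists r.
  rewrite BF in BH Bind Bmax Br; have fF := (zindependent_fset F).1 Bind.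
  have -> : r = #|` F|.
    exact/esym/card_eq_fsetP.
  rewrite -(size_map (@toQ n) F) -(eqP fF); congr (\dim _); apply/eqP.
  rewrite eqEsubv; apply/andP; split; apply: qspan_le => x xX; first exact/HX/BH.
  apply/negPn/negP => xF.
  have xF' : x \notin F by apply: contra xF; exact: mem_qspan.
  have : [set` (x |` F)%fset] = [set` F].
    apply: Bmax => [y /= yF|y /=|]; first by rewrite !inE yF orbT.
      by rewrite !inE => /predU1P[->|/BH//]; exact: XH.
    by apply/zindependent_fset; rewrite qfreeU1// xF.
  by move/seteqP => [/(_ x)] /=; rewrite !inE eqxx (negbTE xF') => /(_ isT).
have [F [FX fF XF]] := exists_qbasis X.
exfalso; apply: (none #|` F|); exists [set` F]; last exact/card_eq_fsetP.
split=> [x /FX/XH//||C FC CH Cind]; first exact/zindependent_fset.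
apply/seteqP; split=> // x Cx; apply/negPn/negP => xF.
have : qfree (x |` F)%fset.
  apply/zindependent_fset; apply: sub_zindependent Cind => y /=.
  by rewrite !inE => /predU1P[->//|/FC].
rewrite qfreeU1// => /andP[/negP + _]; apply.
exact: subvP XF _ (HX _ (CH _ Cx)).
Qed.

Lemma exists_qspan H : exists X, (forall x, x \in X -> H x) /\
  (forall x, H x -> toQ x \in qspan X).
Proof.
(* A list in [H] whose span has the largest possible dimension must span all of [H]. *)
pose P k := `[< exists2 X, (forall x, x \in X -> H x) & \dim (qspan X) = k >].
have exP : exists k, P k by exists (\dim (qspan [::])); apply/asboolP; exists [::].
have leP k : P k -> (k <= \dim {: 'rV[rat]_n})%N.
  by move=> /asboolP[X _ <-]; rewrite dimvS ?subvf.
have [k /asboolP[X XH Xk] kmax] := ex_maxnP exP leP.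
exists X; split=> // x Hx; apply/negPn/negP => xX.
have /kmax : P (\dim (qspan (x :: X))).
  by apply/asboolP; exists (x :: X) => // y; rewrite inE => /predU1P[->|/XH].
apply/negP; rewrite -ltnNge -Xk.
have sub : (qspan X <= qspan (x :: X))%VS.
  by apply: qspan_le => y yX; apply: mem_qspan; rewrite inE yX orbT.
rewrite ltn_neqAle dimvS// andbT; apply: contra xX => /eqP d.
have /eqP -> : qspan X == qspan (x :: X) by rewrite eqEdim sub d leqnn.
by apply: mem_qspan; rewrite mem_head.
Qed.

(** The list comes from a basis of [W] by clearing denominators. *)
Lemma exists_int_span W : exists X,
  {in X, forall x, toQ x \in W} /\ (W <= qspan X)%VS.
Proof.
have h (v : 'rV[rat]_n) := toQ_multiple v.
suff gen (s : seq 'rV[rat]_n) : {subset s <= W} -> exists X,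
    {in X, forall x, toQ x \in W} /\ {in s, forall v, v \in qspan X}.
  have [|X [XW WX]] := gen (vbasis W); first by move=> v; exact: vbasis_mem.
  by exists X; split=> //; rewrite -(span_basis (vbasisP W)); apply/span_subvP.
elim: s => [|v s IH] sW; first by exists [::].
have [|X [XW sX]] := IH; first by move=> w ws; apply: sW; rewrite inE ws orbT.
have [D D0 [x xD]] := h v.
exists (x :: X); split=> y; rewrite inE => /predU1P[->|yX].
- by rewrite xD memvZ// sW// mem_head.
- exact: XW.
- rewrite -[v](scalerK (_ : (D%:~R : rat) != 0)) ?intr_eq0// -xD memvZ//.
  by apply: mem_qspan; rewrite mem_head.
- apply: subvP (sX _ yX); apply: qspan_le => z zX.
  by apply: mem_qspan; rewrite inE zX orbT.
Qed.

End Rank.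

(** * Images of grids *)

Lemma card_imfset_factor (T : choiceType) (T1 T2 : choiceType) (E : {fset T})
    (f : T -> T1) (g : T -> T2) :
  {in E &, forall x y, f x = f y -> g x = g y} ->
  (#|` [fset g x | x in E]%fset| <= #|` [fset f x | x in E]%fset|)%N.
Proof.
move=> fg; have [->|[x0 x0E]] := fset_0Vmem E; first by rewrite !imfset0.
pose G w := g (xget x0 [set x | x \in E /\ f x = w]).
have GE x : x \in E -> G (f x) = g x.
  move=> xE; rewrite /G; case: xgetP => [y _ [yE fyx]|/(_ x)[//]].
  exact: fg.
have := leq_imfset_card imfset_key G (mem [fset f x | x in E]%fset); apply: leq_trans.
apply: fsubset_leq_card; apply/fsubsetP => _ /imfsetP[x /= xE ->].
by rewrite -GE//; apply: in_imfset; exact: in_imfset.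
Qed.

Section LatticeMap.
Variables (d n : nat) (phi : {additive 'rV[int]_d -> 'rV[int]_n}).

Definition toQ_map : 'Hom('rV[rat]_d, 'rV[rat]_n) :=
  linfun (mulmxr (\matrix_i toQ (phi (delta_mx 0 i)))).

Lemma toQ_mapE x : toQ_map (toQ x) = toQ (phi x).
Proof.
rewrite lfunE /= [in RHS](row_sum_delta x) mulmx_sum_row.
rewrite [in RHS](eq_bigr (fun i => delta_mx 0 i *~ x 0 i)); last first.
  by move=> i _; rewrite -scaler_int intz.
rewrite raddf_sum (eq_bigr (fun i => phi (delta_mx 0 i) *~ x 0 i)); last first.
  by move=> i _; rewrite raddfMz.
rewrite toQ_lincomb; apply: eq_bigr => i _.
by rewrite rowK mxE.
Qed.

Lemma limg_qspan X : (toQ_map @: qspan X)%VS = qspan (map phi X).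
Proof.
rewrite /qspan limg_span -!map_comp; congr (<<_>>)%VS.
by apply: eq_map => x /=; exact: toQ_mapE.
Qed.

Lemma rank_image (H : set 'rV[int]_d) X : (forall x, x \in X -> H x) ->
  (forall x, H x -> toQ x \in qspan X) ->
  rank (phi @` H) = \dim (toQ_map @: qspan X).
Proof.
move=> XH HX; rewrite limg_qspan; apply: rank_qspan => y.
  by move=> /mapP[x /XH Hx ->]; exists x.
by move=> [x /HX xX <-]; rewrite -limg_qspan -toQ_mapE memv_img.
Qed.

End LatticeMap.

Section Grids.
Variables (n r : nat) (y : 'I_r -> 'rV[int]_n).

Definition grid N : {fset 'rV[int]_n} :=
  [fset \sum_i y i *~ (c i)%:Z | c : {ffun 'I_r -> 'I_N} in predT]%fset.

(** Coordinates in a basis of the span, multiplied by a common denominator, are integers of absolute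
    value at most [N * M]; each takes at most [2 * N * M + 1 <= (2 * M + 1) * N] values. *)
Lemma card_grid_le : exists2 C, (0 < C)%N & forall N, (0 < N)%N ->
  (#|` grid N| <= C * N ^ \dim (qspan (codom y)))%N.
Proof.
set W := qspan _; set k := \dim W; pose b := vbasis W.
have [D D0 [q qD]] := common_denominator (enum {: 'I_r * 'I_k})
   (fun p => coord b p.2 (toQ (y p.1))).
pose M := (\sum_i \sum_l `|q (i, l)|)%N.
exists (M.*2.+1 ^ k)%N => [|N N0]; first by rewrite expn_gt0.
rewrite -expnMn.
pose z (c : {ffun 'I_r -> 'I_N}) := \sum_i y i *~ (c i)%:Z.
pose zeta (c : {ffun 'I_r -> 'I_N}) l : int := \sum_i (c i)%:Z * q (i, l).
have zW c : toQ (z c) \in W.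
  rewrite /z toQ_lincomb memv_suml// => i _; rewrite memvZ//.
  by apply: mem_qspan; exact: codom_f.
have zetaE c l : (zeta c l)%:~R = D%:~R * coord b l (toQ (z c)).
  rewrite /z toQ_lincomb linear_sum /= mulr_sumr rmorph_sum /=.
  apply: eq_bigr => i _; rewrite linearZ /= rmorphM /= qD ?mem_enum//.
  by rewrite mulrCA.
have zeta_le c l : (`|zeta c l| <= N * M)%N.
  rewrite -(ler_nat int) natr_absz intz.
  apply: le_trans (ler_norm_sum _ _ _) _.
  rewrite natrM /M natr_sum mulr_sumr; apply: ler_sum => i _.
  rewrite normrM -natz normr_nat; apply: ler_pM => //.
    by rewrite ler_nat ltnW.
  rewrite natr_sum (bigD1 l)//= natr_absz intz lerDl.
  by apply: sumr_ge0 => j _; rewrite ler0n.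
(* The shift by [N * M] makes the scaled coordinates nonnegative; [.-1.+1] gives [inord] the
   successor form it needs. *)
pose code c : {ffun 'I_k -> 'I_(M.*2.+1 * N).-1.+1} :=
  [ffun l => inord (absz (zeta c l + (N * M)%N%:Z))].
have code_inj c c' : code c = code c' -> z c = z c'.
  move=> cc'; apply: (@toQ_inj n); rewrite (coord_vbasis (zW c)) (coord_vbasis (zW c')).
  apply: eq_bigr => l _; congr (_ *: _).
  have D0' : (D%:~R : rat) != 0 by rewrite intr_eq0.
  apply: (mulfI D0'); rewrite -!zetaE; congr intr.
  have zl c0 : (absz (zeta c0 l + (N * M)%N%:Z)%R < (M.*2.+1 * N).-1.+1)%N.
    have := zeta_le c0 l; nia.
  move/ffunP/(_ l)/(congr1 (@nat_of_ord _)): cc'; rewrite !ffunE !inordK//.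
  have := zeta_le c l; have := zeta_le c' l; lia.
pose G w := if [pick c | code c == w] is Some c then z c else 0.
have := leq_imfset_card imfset_key G (mem {: {ffun 'I_k -> 'I_(M.*2.+1 * N).-1.+1}}).
rewrite -cardE card_ffun !card_ord [X in (_ <= X ^ _)%N -> _]prednK ?muln_gt0//.
move=> /(leq_trans _); apply.
apply/fsubset_leq_card/fsubsetP => _ /imfsetP[c _ ->].
apply/imfsetP; exists (code c) => //; rewrite /G.
by case: pickP => [c' /eqP/code_inj->//|/(_ c)]; rewrite eqxx.
Qed.

Lemma card_grid N : injective y -> qfree (codom y) -> #|` grid N| = (N ^ r)%N.
Proof.
move=> yI fy; rewrite card_imfset /=; first by rewrite -cardE card_ffun !card_ord.
move=> c c' cc'; apply/ffunP => i; apply/val_inj/eqP.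
have uy : uniq (codom y) by rewrite map_inj_uniq ?enum_uniq.
(* Two representations of one grid point differ by an integral relation with these coefficients. *)
pose e x : int := if [pick i | y i == x] is Some i then (c i)%:Z - (c' i)%:Z else 0.
have eE l : e (y l) = (c l)%:Z - (c' l)%:Z.
  by rewrite /e; case: pickP => [l' /eqP/yI->//|/(_ l)]; rewrite eqxx.
have := (qfreeP uy).1 fy e _ (y i) (codom_f _ _); rewrite eE => h.
rewrite -eqz_nat -subr_eq0; apply/eqP/h.
rewrite /codom /image_mem big_map big_enum /=.
rewrite (eq_bigr (fun l => y l *~ (c l)%:Z - y l *~ (c' l)%:Z)); last first.
  by move=> l _; rewrite eE mulrzBr.
by rewrite sumrB cc' subrr.
Qed.

End Grids.

(** * The theorem *)

Lemma powR_natE (R : realType) (n : nat) (a : R) : (0 < n)%N ->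
  n%:R `^ a = expR (a * ln n%:R).
Proof. by move=> n0; rewrite /powR pnatr_eq0 gtn_eqF. Qed.

(** Taking logarithms bounds [(r - S) * ln N] by the constant [Q], which fails for [N] above
    [expR (Q / (r - S))] if [S < r]. *)
Lemma exponent_le (R : realType) (m r : nat) (s : 'I_m -> R) (C e : 'I_m -> nat) :
  (forall j, (0 < C j)%N) ->
  (forall N, (0 < N)%N ->
    (N ^ r)%:R <= \prod_(j < m) ((C j * N ^ e j)%:R `^ s j)) ->
  r%:R <= \sum_(j < m) s j * (e j)%:R.
Proof.
move=> C0 h; rewrite leNgt; apply/negP => lt_r.
set S := \sum_(j < m) _ in lt_r.
pose Q := \sum_(j < m) s j * ln (C j)%:R.
have d0 : 0 < r%:R - S by rewrite subr_gt0.
have hN N : (0 < N)%N -> (r%:R - S) * ln N%:R <= Q.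
  move=> N0; have NR : 0 < N%:R :> R by rewrite ltr0n.
  have := h N N0.
  rewrite (eq_bigr (fun j => expR (s j * ln (C j)%:R + s j * (e j)%:R * ln N%:R))).
    rewrite -expR_sum natrX -[X in X <= _]lnK ?posrE ?exprn_gt0// lnXn// ler_expR.
    rewrite big_split /= -mulr_suml -/S -/Q -mulr_natl; lra.
  move=> j _; rewrite powR_natE ?muln_gt0 ?C0 ?expn_gt0 ?N0//.
  by rewrite natrM natrX lnM ?posrE ?exprn_gt0 ?ltr0n// lnXn// -mulr_natl; congr expR; ring.
have b0 := expR_ge0 (Q / (r%:R - S)).
have := archi_boundP b0; set N := Num.Def.archi_bound _ => ltN.
have N0 : (0 < N)%N by rewrite -(ltr0n R); apply: le_lt_trans ltN.
have := hN N N0; apply/negP; rewrite -ltNge mulrC -ltr_pdivrMr//.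
by rewrite -ltr_expR lnK// posrE ltr0n.
Qed.

Lemma sum_fset_const (R : pzRingType) (T : choiceType) (E : {fset T}) (a : R) :
  \sum_(x <- E) a = a *+ #|` E|.
Proof. by rewrite big_const_seq count_predT iter_addr addr0. Qed.

Theorem theorem3p2 (R : realType) (m d : nat) (dd : 'I_m -> nat)
    (phi : forall j : 'I_m, {additive 'rV[int]_d -> 'rV[int]_(dd j)})
    (s : 'I_m -> R) (hs : forall j, 0 <= s j <= 1) :
  (forall H : set 'rV[int]_d, zmod_closed [in H] ->
     (rank H)%:R <= \sum_(j < m) s j * (rank (phi j @` H))%:R)
  <->
  (forall E : {fset 'rV[int]_d}, E != fset0 ->
     #|` E|%:R <= \prod_(j < m) (#|` [fset phi j x | x in E]%fset|%:R `^ s j)).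
Proof.
split=> [A E E0|B H _].
- pose f j := toQ_map (phi j).
  have cond : rank_condition (fun j => lker (f j)) s 0 fullv.
    move=> W _ _; have [X [XW WX]] := exists_int_span W.
    have {}WX : qspan X = W by apply/eqP; rewrite eqEsubv WX qspan_le.
    (* (A) is applied to the lattice points of [W], whose rank is the dimension of [W]. *)
    pose H := [set x | toQ x \in W].
    have HX x : H x -> toQ x \in qspan X by rewrite WX.
    have := A H; rewrite (rank_qspan XW HX) WX dimv0 subr0 => AH.
    apply: le_trans (AH _) _.
      split=> [|x y]; rewrite !inE /H /= ?toQ0 ?mem0v// toQB.
      exact: memvB.
    apply: ler_sum => j _; rewrite (rank_image _ XW HX) WX add0v -natrB ?dimvS ?addvSr//.
    rewrite ler_wpM2l//; first by case/andP: (hs j).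
    (* Both sides equal the dimension of [W] minus that of its intersection with the kernel. *)
    rewrite ler_nat; have := dimv_sum_cap W (lker (f j)).
    have := limg_ker_dim (f j) W; rewrite /f; lia.
  have := BL_inequality_of_rank (sub0v _) hs cond.
  pose n j := #|` [fset phi j x | x in E]%fset|.
  have n0 j : (0 < n j)%N.
    rewrite cardfs_gt0; have /fset0Pn[x xE] := E0.
    by apply/fset0Pn; exists (phi j x); exact: in_imfset.
  (* The constant weights [1 / n j] have total at most 1, since the [j]-th image has at most [n j]
     points. *)
  move=> /(_ [fset toQ x | x in E]%fset (fun j _ => - ln (n j)%:R)) BL.
  have {}BL : #|` E|%:R * expR (- \sum_j s j * ln (n j)%:R) <= 1.
    rewrite mulr_natl; apply: le_trans (BL _ _ _).
    + rewrite sum_fset_const card_imfset; last exact: toQ_inj.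
      by rewrite -sumrN [in leRHS](eq_bigr _ (fun j _ => mulrN (s j) _)).
    + by move=> x y _ _; rewrite memvf.
    + by move=> x y _ _; rewrite memv0 subr_eq0 => /eqP.
    + move=> j; rewrite sum_fset_const expRN lnK ?posrE ?ltr0n// -[leLHS]mulr_natr.
      rewrite ler_pdivrMl ?ltr0n// mulr1 ler_nat.
      rewrite -imfset_comp; apply: card_imfset_factor => x y _ _ xy /=.
      apply/eqP; rewrite eq_residue add0v memv_ker linearB /= !toQ_mapE xy subrr.
      by [].
  rewrite (eq_bigr (fun j => expR (s j * ln (n j)%:R))) => [|j _]; last first.
    exact/powR_natE/n0.
  rewrite -expR_sum; move: BL.
  by rewrite expRN -[_ * _^-1]/(_ / _) ler_pdivrMr ?expR_gt0// mul1r.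
- have [X [XH HX]] := exists_qspan H.
  have [F [FX fF XF]] := exists_qbasis X.
  have FH x : x \in F -> H x by move=> /FX/XH.
  have HF x : H x -> toQ x \in qspan F by move=> /HX; exact: subvP.
  pose y (i : 'I_#|` F|) := (enum_fset F)`_i.
  have codom_y : codom y = F.
    rewrite /codom /image_mem -[RHS](mkseq_nth 0) /mkseq -val_enum_ord -map_comp.
    by rewrite enumT.
  have y_inj : injective y.
    by move=> i k /eqP; rewrite nth_uniq ?fset_uniq// => /eqP/val_inj.
  have rH : rank H = #|` F|.
    by rewrite (rank_qspan FH HF) (eqP (fF : free _)) size_map.
  rewrite rH.
  have rphi j : rank (phi j @` H) = \dim (qspan (codom (phi j \o y))).
    rewrite (rank_image _ FH HF) limg_qspan; congr (\dim (qspan _)).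
    have -> : codom (phi j \o y) = map (phi j) (codom y) by exact: map_comp.
    by rewrite codom_y.
  have /choice[C Cb] j : exists C, (0 < C)%N /\ forall N, (0 < N)%N ->
      (#|` grid (phi j \o y) N| <= C * N ^ rank (phi j @` H))%N.
    by have [C ? ?] := card_grid_le (phi j \o y); exists C; rewrite rphi.
  apply: (@exponent_le _ _ _ _ C) => [j|N N0]; first by case: (Cb j).
  have cg : #|` grid y N| = (N ^ #|` F|)%N by rewrite card_grid// codom_y.
  rewrite -cg; apply: le_trans (B _ _) _; first by rewrite -cardfs_gt0 cg expn_gt0 N0.
  apply: ler_prod => j _; rewrite powR_ge0 /= ge0_ler_powR ?nnegrE//.
    by case/andP: (hs j).
  rewrite ler_nat; apply: leq_trans ((Cb j).2 N N0).
  (* [phi j] sends a grid point to the point with the same coefficients in the grid of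
     [phi j \o y]. *)
  apply/fsubset_leq_card/fsubsetP => _ /imfsetP[_ /imfsetP[c _ ->] ->].
  apply/imfsetP; exists c => //; rewrite raddf_sum.
  by apply: eq_bigr => i _; rewrite raddfMz.
Qed.
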